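(* Let $T$ be a caterpillar such that $|V(T)|\ge 2$. If $s'(T)$ is the sequence obtained by removing from the reduced degree sequence $s(T)$ those terms equal to the integer $3$ (i.e., $s'(T)$ is the subsequence of those terms belonging to $\{1,2,4\}$), then $$h(T)=\ell(T)+Z(s'(T)),$$ where $h(T)$ is the $P_3$-hull number of $T$ and $\ell(T)$ is the number of leaves of $T$.
   Context: Graphs are finite, simple and undirected. $d_T(v)$ is the degree of $v$. A pendant vertex (leaf) is a vertex of degree $1$. A caterpillar is a tree such that the removal of all its pendant vertices yields a path (possibly with one or no vertices). A set $S\subseteq V(G)$ is $P_3$-convex if every vertex of $V(G)\setminus S$ has at most one neighbor in $S$. The $P_3$-hull of $R\subseteq V(G)$ is the minimum $P_3$-convex set containing $R$; $R$ is a $P_3$-hull set of $G$ if its $P_3$-hull is $V(G)$. The $P_3$-hull number $h(G)$ is the minimum cardinality of a $P_3$-hull set of $G$. Reduced degree sequence: a dominating path of a graph is a path whose vertex set is a dominating set. A caterpillar $T$ with at least two vertices has a dominating path $P=v_1,\ldots,v_k$ whose endpoints are leaves of $T$. Put $\tilde d_T(w)=\min\{d_T(w),4\}$. The sequence $s(T)=\tilde d_T(v_1),\tilde d_T(v_2),\ldots,\tilde d_T(v_k)$ is the reduced degree sequence of $T$; it is unique up to reversal. For a sequence $s$ of positive integers, $Z(s)=\sum_i\lfloor z_i/2\rfloor$, where the sum is over all maximal subsequences of consecutive terms of $s$ containing only the integer $2$, and the $z_i$ are the lengths of these maximal subsequences. *)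

(* Defs.v *)
From HB Require Import structures.
From mathcomp Require Import all_boot.

Set Implicit Arguments.
Unset Strict Implicit.
Unset Printing Implicit Defensive.

Section Graphs.

(* A finite simple graph is a symmetric irreflexive relation [e] on a finType;
   both properties are part of [tree] below. *)
Variables (V : finType) (e : rel V).

Definition degree (v : V) : nat := #|[set u | e v u]|.

Definition leaf (v : V) : bool := degree v == 1.

Definition leaves : {set V} := [set v | leaf v].

Definition simple_graph : Prop := symmetric e /\ irreflexive e.

Definition connected : Prop := 0 < #|V| /\ forall x y, connect e x y.

Definition acyclic : Prop := forall c : seq V, 2 < size c -> ~ ucycle e c.

Definition tree : Prop := [/\ simple_graph, connected & acyclic].

(* The subgraph induced by [A] is isomorphic to the path with [k] vertices, for
   some [k]; the empty graph ([k = 0]) is allowed. *)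
Definition induces_path (A : {set V}) : Prop :=
  exists (k : nat) (f : 'I_k -> V),
    [/\ injective f,
        [set f i | i : 'I_k] = A
      & forall i j : 'I_k, e (f i) (f j) = (i.+1 == j) || (j.+1 == i)].

Definition caterpillar : Prop := tree /\ induces_path (~: leaves).

Definition P3_convex (S : {set V}) : bool :=
  [forall v, (v \notin S) ==> (#|[set u in S | e v u]| <= 1)].

Definition P3_hull (R : {set V}) : {set V} :=
  \bigcap_(S : {set V} | P3_convex S && (R \subset S)) S.

Definition P3_hull_set (R : {set V}) : bool := P3_hull R == [set: V].

Definition P3_hull_number : nat :=
  #|[arg min_(R < [set: V] | P3_hull_set R) #|R| ]|.

Definition dominating (S : {set V}) : Prop :=
  forall v, v \in S \/ exists2 u, u \in S & e u v.

(* The two ends are distinct vertices: this only matters for the graph with two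
   vertices, where a single vertex would also be a dominating path. *)
Definition dominating_leaf_path (p : seq V) : Prop :=
  if p is x :: q then
    [/\ path e x q && uniq (x :: q), dominating [set v in x :: q],
        x != last x q, leaf x & leaf (last x q)]
  else False.

Definition reduced_degree (v : V) : nat := minn (degree v) 4.

(* [s] is the reduced degree sequence of the graph, which is determined up to
   reversal. *)
Definition reduced_degree_sequence (s : seq nat) : Prop :=
  exists2 p : seq V, dominating_leaf_path p
    & s = [seq reduced_degree v | v <- p].

End Graphs.

(* The positions i, ..., j - 1 of [s] form a maximal block of terms equal to 2;
   the default value 0 of [nth] handles the right end of [s]. *)
Definition maximal_run2 (s : seq nat) (i j : nat) : bool :=
  [&& i < j <= size s,
      all (pred1 2) (take (j - i) (drop i s)),
      (i == 0) || (nth 0 s i.-1 != 2)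
    & nth 0 s j != 2].

Definition Z (s : seq nat) : nat :=
  \sum_(0 <= i < size s) \sum_(0 <= j < (size s).+1 | maximal_run2 s i j)
    (j - i)./2.

Section Facts.

Variables (V : finType) (e : rel V).

Lemma sub_P3_hull (R : {set V}) : R \subset P3_hull e R.
Proof. by apply/bigcapsP => S /andP[]. Qed.

Lemma P3_hull_min (R S : {set V}) :
  P3_convex e S -> R \subset S -> P3_hull e R \subset S.
Proof. by move=> cS RS; apply: bigcap_inf; rewrite cS. Qed.

Lemma P3_hull_convex (R : {set V}) : P3_convex e (P3_hull e R).
Proof.
apply/forallP => v; apply/implyP => vN.
have [S /andP[/andP[cS RS] vS]] :
    exists S : {set V}, (P3_convex e S && (R \subset S)) && (v \notin S).
  apply/existsP; apply: contraNT vN; rewrite negb_exists => /forallP H.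
  by apply/bigcapP => S PS; move: (H S); rewrite PS negbK.
have /implyP/(_ vS) := forallP cS v; apply: leq_trans.
apply: subset_leq_card; apply/subsetP => u; rewrite !inE => /andP[uH ->].
by rewrite (subsetP (P3_hull_min cS RS)).
Qed.

Lemma P3_hull_setT : P3_hull_set e [set: V].
Proof. by rewrite /P3_hull_set eqEsubset subsetT sub_P3_hull. Qed.

Lemma P3_hull_number_attained :
  exists2 R : {set V}, P3_hull_set e R & #|R| = P3_hull_number e.
Proof.
by rewrite /P3_hull_number; case: arg_minnP => [|R]; [exact: P3_hull_setT | exists R].
Qed.

Lemma P3_hull_number_min (R : {set V}) :
  P3_hull_set e R -> P3_hull_number e <= #|R|.
Proof.
by rewrite /P3_hull_number; case: arg_minnP => [|S _]; [exact: P3_hull_setT | exact].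
Qed.

Lemma leaf_nbr_uniq x y z : leaf e x -> e x y -> e x z -> y = z.
Proof.
move=> /cards1P[w Hw] xy xz.
have : y \in [set u | e x u] by rewrite inE.
have : z \in [set u | e x u] by rewrite inE.
by rewrite Hw !inE => /eqP-> /eqP->.
Qed.

Lemma connected_closed (A : {set V}) x :
  connected e -> x \in A -> (forall y z, y \in A -> e y z -> z \in A) ->
  forall v, v \in A.
Proof.
move=> [_ co] xA clA v; have /connectP[p + ->] := co x v.
by elim: p x xA {co} => //= y p IH x xA /andP[xy]; apply: IH; apply: clA xy.
Qed.

Lemma exists_other (A : {set V}) (y : V) :
  #|A| != 0 -> #|A| != 1 -> exists2 z, z \in A & z != y.
Proof.
move=> A0 A1; suff : 0 < #|A :\ y|.
  by case/card_gt0P => z; rewrite !inE => /andP[zy zA]; exists z.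
rewrite lt0n; apply: contraNneq A1 => E.
by move: A0; rewrite (cardsD1 y A) E addn0; case: (y \in A).
Qed.

(* The hypothesis of a reduced degree sequence is never vacuous. *)
Lemma reduced_degree_sequence_exists :
  caterpillar e -> 1 < #|V| -> exists s, reduced_degree_sequence e s.
Proof.
move=> [[[sym irr] co _] [k [f [finj fim fe]]]] V1.
suff [p Hp] : exists p, dominating_leaf_path e p.
  by exists [seq reduced_degree e v | v <- p], p.
have deg0 x : degree e x != 0.
  apply/eqP => /eqP; rewrite cards_eq0 => /eqP d0.
  have H : forall v, v \in [set x].
    apply: (connected_closed (x := x)) => //; first by rewrite inE.
    move=> y z; rewrite inE => /eqP-> xz.
    have : z \in [set u | e x u] by rewrite inE.
    by rewrite d0 in_set0.
  have := cards1 x; suff -> : [set x] = [set: V] by rewrite cardsT => E; rewrite E in V1.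
  by apply/setP => v; rewrite H inE.
have inner v : reflect (exists i, v = f i) (~~ leaf e v).
  have -> : ~~ leaf e v = (v \in [set f i | i : 'I_k]) by rewrite fim !inE.
  by apply: (iffP imsetP) => -[i]; [move=> _ ->|move=> ->]; exists i.
have nbr v : exists u, e v u.
  by have := deg0 v; rewrite cards_eq0 => /set0Pn[u]; rewrite inE; exists u.
have pairs x y : leaf e x -> leaf e y -> e x y -> forall v, v \in [set x; y].
  move=> lx ly xy; apply: (connected_closed (x := x)) => //; first by rewrite !inE eqxx.
  move=> u v; rewrite !inE => /orP[]/eqP-> uv.
    by rewrite (leaf_nbr_uniq lx uv xy) eqxx orbT.
  by rewrite (leaf_nbr_uniq ly uv (y := v) (z := x)) ?eqxx // sym.
case: k f finj fim fe inner => [|k] f finj fim fe inner.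
  have allleaf v : leaf e v by apply: contraT => /inner[[]].
  have /card_gt0P[x _] : 0 < #|V| by apply: ltnW.
  have [y xy] := nbr x; exists [:: x; y]; split => //=.
  - rewrite xy !inE /= andbT; apply/eqP => E; by rewrite E irr in xy.
  - by move=> v; left; have := pairs x y (allleaf x) (allleaf y) xy v; rewrite !inE.
  - by apply/eqP => E; rewrite E irr in xy.
have notleaf i : ~~ leaf e (f i) by apply/inner; exists i.
have leafnbr v : leaf e v -> exists i, e v (f i).
  move=> lv; have [u vu] := nbr v.
  case: (boolP (leaf e u)) => [lu|/inner[i E]]; last by exists i; rewrite -E.
  have := pairs v u lv lu vu (f ord0).
  by rewrite !inE => /orP[]/eqP E; have := notleaf ord0; rewrite E ?lv ?lu.
have [y wy ly] : exists2 y, e (f ord_max) y & leaf e y.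
  have [y] := exists_other (f (inord k.-1)) (deg0 (f ord_max)) (notleaf ord_max).
  rewrite inE => wy yN; exists y => //; apply: contraT => /inner[j yj].
  move: wy yN; rewrite yj fe /= => jk /eqP[]; congr f; apply: val_inj => /=.
  have kj : k = j.+1.
    case/orP: jk => /eqP // jk; by have := ltn_ord j; rewrite -jk ltnn.
  by rewrite inordK ?ltnS ?leq_pred // [X in X.-1]kj.
have [x [ux lx xy]] : exists x, [/\ e (f ord0) x, leaf e x & x != y].
  have [k0|k0] := posnP k.
    have [x] := exists_other y (deg0 (f ord0)) (notleaf ord0).
    rewrite inE => ux xN; exists x; split=> //; apply: contraT => /inner[j xj].
    move: ux; rewrite xj (_ : j = ord0) ?irr //; apply: val_inj => /=.
    by have := ltn_ord j; rewrite [X in _ < X.+1]k0; case: (nat_of_ord j).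
  have [x] := exists_other (f (inord 1)) (deg0 (f ord0)) (notleaf ord0).
  rewrite inE => ux xN; have lx : leaf e x.
    apply: contraT => /inner[j xj]; move: ux xN; rewrite xj fe /= orbF => /eqP j1.
    by case/eqP; congr f; apply: val_inj; rewrite /= inordK ?j1.
  exists x; split=> //; apply/eqP => xy.
  have : f ord0 = f ord_max by apply: (leaf_nbr_uniq lx); rewrite sym // xy.
  by move=> /finj /(congr1 val) /= E; rewrite -E in k0.
pose s := [seq f i | i <- enum 'I_k.+1].
have inner_s v : leaf e v = (v \notin s).
  apply/idP/idP => [lv|].
    by apply/mapP => -[i _ E]; have := notleaf i; rewrite -E lv.
  by apply: contraNT => /inner[i ->]; rewrite map_f ?mem_enum.
exists (x :: rcons s y); split; rewrite ?last_rcons //.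
- apply/andP; split; last first.
    rewrite cons_uniq rcons_uniq mem_rcons inE negb_or xy -!inner_s lx ly /=.
    by rewrite map_inj_uniq ?enum_uniq.
  rewrite rcons_path; apply/andP; split; last first.
    by rewrite /s enum_ordSr map_rcons last_rcons.
  have : sorted e s.
    apply/(sortedP x) => i; rewrite /s size_map size_enum_ord => ik.
    have nE m : m < k.+1 ->
        nth x [seq f i | i <- enum 'I_k.+1] m = f (nth ord0 (enum 'I_k.+1) m).
      by move=> mk; rewrite (nth_map ord0) ?size_enum_ord.
    have ik1 := ltnW ik; rewrite !nE // fe.
    by rewrite !nth_enum_ord ?eqxx // ltnW.
  by rewrite /s enum_ordSl /= sym ux.
- move=> v; rewrite !inE mem_rcons !inE.
  case: (boolP (leaf e v)) => [lv|]; last by rewrite inner_s negbK => ->; left; rewrite !orbT.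
  have [i vi] := leafnbr v lv; right; exists (f i); last by rewrite sym.
  by rewrite !inE mem_rcons inE map_f ?mem_enum ?orbT.
Qed.

End Facts.

(* Main.v *)
Require Import Defs.
From mathcomp Require Import all_boot.
From mathcomp Require Import zify.

Set Implicit Arguments.
Unset Strict Implicit.
Unset Printing Implicit Defensive.

(** Read the hull as an infection: a vertex outside becomes infected once it has
two infected neighbours.  A leaf can never be infected, so a hull set contains
all leaves.  Fix the dominating path; since the graph is a tree, every
neighbour of an interior path vertex other than its two path neighbours is a
leaf ([spine_nbr]).  Once the leaves are infected, an interior path vertex of
degree at least 4 gets infected outright, one of degree 3 needs a single
infected path neighbour, hence merely relays the infection, and one of degree 2
needs both path neighbours.  Deleting the relays, the cost beyond the leaves is
that of the blocks of consecutive 2's, and [greedy] selects every second vertex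
of each block.

The selection suffices: a vertex of degree 2 that is not selected is followed,
up to relays, by a vertex that is selected or infected anyway, so the infection
comes back to it from the right ([pending_reaches]) and sweeps the path from
left to right ([greedy_spreads]).

The selection is optimal: a stretch of the path with two vertices of degree 2
at its ends and only degree 3 in between is sealed, i.e. each of its vertices
has at most one neighbour outside, so that its complement is convex and every
hull set meets it ([sealed_meets_hull_set], [sealed_segment]).  Each vertex
selected by [greedy] closes one such stretch, and these stretches are disjoint
([greedy_le_count]).

Finally, the number of selected vertices is [Z] of the degree sequence without
its 3's ([size_greedy_Z]): both satisfy the same recursion along the
sequence. *)

(** * The greedy selection and the function Z *)

(** The flag [pending] records that an unselected vertex of degree 2 has been
met with only degree 3 since then; the next vertex of degree 2 is then
selected. *)
Fixpoint greedy (T : Type) (d : T -> nat) (pending : bool) (p : seq T) :=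
  if p is v :: q then
    if d v == 3 then greedy d pending q
    else if d v == 2 then
      if pending then v :: greedy d false q else greedy d true q
    else greedy d false q
  else [::].

(** The maximal runs of [s] as they appear when [s] is preceded by the term [c]:
a run at the very start of [s] is not maximal if [c] is 2.  This is the
generalization of [maximal_run2] that is stable under removing the head. *)
Definition run_after (c : nat) (s : seq nat) (i j : nat) : bool :=
  [&& i < j <= size s,
      all (pred1 2) (take (j - i) (drop i s)),
      nth 0 (c :: s) i != 2
    & nth 0 s j != 2].

Definition Z_after (c : nat) (s : seq nat) : nat :=
  \sum_(0 <= i < size s) \sum_(0 <= j < (size s).+1 | run_after c s i j)
    (j - i)./2.

Definition lead2 (s : seq nat) : nat := find (predC1 2) s.

Lemma Z_after0 s : Z s = Z_after 0 s.
Proof.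
by apply: eq_bigr => i _; apply: eq_bigl => j; case: i => [|i].
Qed.

(** The only position at which a run starting at 0 can end is [lead2 s]. *)
Lemma lead2P s j :
  [&& j <= size s, all (pred1 2) (take j s) & nth 0 s j != 2] = (j == lead2 s).
Proof.
elim: s j => [|a s IH] [|j] //=; rewrite /lead2 /=.
  by case: (a == 2).
by case: (a =P 2) => [|_]; rewrite ?andbF //= eqSS -IH.
Qed.

Lemma Z_after_cons c d s :
  Z_after c (d :: s) = (c != 2) * (lead2 (d :: s))./2 + Z_after d s.
Proof.
rewrite {1}/Z_after big_nat_recl //; congr (_ + _).
  rewrite (eq_bigl (fun j => ((c != 2) && (0 < j)) && (j == lead2 (d :: s)))).
    rewrite big_nat1_cond_eq ltnS find_size subn0.
    by case: (lead2 _) => [|l]; case: (c != 2); rewrite ?mul1n.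
  move=> j; rewrite /run_after drop0 subn0 -lead2P /=.
  by case: (c != 2); case: (0 < j); rewrite ?andbF.
apply: eq_bigr => i _; rewrite big_ltn_cond // big_add1 /=.
exact: eq_bigl.
Qed.

(** A pending vertex extends the leading run by one; the later runs are those
that are maximal when [s] is preceded by a 2. *)
Lemma size_greedy (T : Type) (d : T -> nat) pending p :
  let s := [seq x <- map d p | x != 3] in
  size (greedy d pending p) = (pending + lead2 s)./2 + Z_after 2 s.
Proof.
elim: p pending => [|v p IH] pending /=.
  by rewrite /Z_after big_nil; case: pending.
case: (d v =P 3) => [_|_] //=; rewrite Z_after_cons mul0n add0n /lead2 /=.
set s := [seq x <- map d p | x != 3] in IH *.
(* The preceding term only decides whether the leading run is counted. *)
have split2 x : Z_after x s = (x != 2) * (lead2 s)./2 + Z_after 2 s.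
  by case: s {IH} => [|y s]; rewrite ?Z_after_cons // /Z_after !big_nil muln0.
case: (d v =P 2) => [->|/eqP/negPf dv] /=; rewrite split2 -/(lead2 s) /=.
  by case: pending => /=; rewrite IH //= add1n.
by rewrite IH dv mul1n addn0; case: pending.
Qed.

Lemma size_greedy_Z (T : Type) (d : T -> nat) p :
  size (greedy d false p) = Z [seq x <- map d p | x != 3].
Proof.
rewrite size_greedy Z_after0; case: [seq _ <- _ | _] => [|x s].
  by rewrite /Z_after !big_nil.
by rewrite !Z_after_cons mul1n.
Qed.

Section Graph.
Variables (V : finType) (e : rel V).
Implicit Types (S C R : {set V}) (p : seq V).

(** * The neighbourhood of a dominating path in a tree *)

Lemma acyclic_path x c :
  acyclic e -> path e x c -> uniq (x :: c) -> e (last x c) x -> size c <= 1.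
Proof.
move=> ac pc uc cx; rewrite leqNgt; apply/negP => c1.
by apply: (ac (x :: c)) => //; rewrite /ucycle uc /= rcons_path pc cx.
Qed.

Lemma path_segment p v z :
  symmetric e -> sorted e p -> uniq p -> v \in p -> z \in p -> v != z ->
  exists c, [/\ path e v c, uniq (v :: c), last v c = z & {subset v :: c <= p}].
Proof.
move=> sym.
have forward a b : sorted e (a ++ v :: b) -> uniq (a ++ v :: b) -> z \in b ->
  exists c, [/\ path e v c, uniq (v :: c), last v c = z
    & {subset v :: c <= a ++ v :: b}].
- move=> so un zb; case/path.splitP: zb so un => b1 b2.
  rewrite -cat_cons => /cat_sorted2[_ /cat_sorted2[so _]] un.
  exists (rcons b1 z); split=> //; last 2 first.
  + by rewrite last_rcons.
  + by move=> y; rewrite !mem_cat => ->; rewrite orbT.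
  by move: un; rewrite catA !cat_uniq => /and3P[/and3P[]].
move=> so un vp; case/splitPr: vp so un => a b so un.
rewrite mem_cat inE => /or3P[za|/eqP->|zb] vz; last 2 first.
- by rewrite eqxx in vz.
- exact: forward.
(* Here [z] precedes [v]: reverse the path. *)
have rE : rev (a ++ v :: b) = rev b ++ v :: rev a.
  by rewrite rev_cat rev_cons cat_rcons.
have [||| c [pc uc lc sc]] := forward (rev b) (rev a).
- by rewrite -rE rev_sorted (eq_sorted (e' := e)) // => x y; rewrite sym.
- by rewrite -rE rev_uniq.
- by rewrite mem_rev.
by exists c; split=> // y /sc; rewrite -rE mem_rev.
Qed.

(** A second neighbour [y] of [z] would lie on the path or be adjacent to a path
vertex [w]; the part of the path from [v] to [y], or to [w], would then close
to a cycle. *)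
Lemma off_path_leaf p v z :
  tree e -> sorted e p -> uniq p -> dominating e [set x in p] ->
  v \in p -> z \notin p -> e v z -> leaf e z.
Proof.
move=> [[sym irr] _ ac] so un dom vp zp vz.
apply: contraT => nlz.
have zN0 : degree e z != 0.
  by rewrite -lt0n; apply/card_gt0P; exists v; rewrite inE sym.
have [y] := exists_other v zN0 nlz; rewrite inE => zy yv.
have vNz : v != z by apply: contraNneq zp => <-.
have yNz : y != z by apply: contraTneq zy => ->; rewrite irr.
case: (boolP (y \in p)) => yp.
  have [|c [pc uc lc sc]] := path_segment sym so un vp yp.
    by rewrite eq_sym.
  have znc : z \notin v :: c by apply: contra zp => /sc.
  have := @acyclic_path z (v :: c) ac; rewrite [last _ _]/= lc [path _ _ _]/=.
  rewrite cons_uniq znc uc pc sym vz sym zy => /(_ isT isT isT) /=.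
  by case: c lc {pc uc sc znc} => //= E; rewrite E eqxx in yv.
have [w wp wy] : exists2 w, w \in p & e w y.
  have [|[w]] := dom y; rewrite inE ?(negPf yp) // => wp wy; by exists w.
case: (eqVneq v w) => [E|vw].
  (* Both attachment points coincide: a triangle. *)
  have uvzy : uniq [:: v; z; y].
    by rewrite /= !inE negb_or vNz (eq_sym v) (eq_sym z) yv yNz.
  by have := acyclic_path ac _ uvzy;
    rewrite /= vz zy (sym y v) E wy => /(_ isT isT).
have [c [pc uc lc sc]] := path_segment sym so un vp wp vw.
have znc : z \notin v :: c by apply: contra zp => /sc.
have ync : y \notin v :: c by apply: contra yp => /sc.
have := @acyclic_path y (z :: v :: c) ac; rewrite [last _ _]/= lc wy.
rewrite ![path _ _ _]/= !cons_uniq znc inE (negPf yNz) ync pc -(cons_uniq v) uc.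
by rewrite sym zy sym vz => /(_ isT isT isT).
Qed.

(** Any other path vertex adjacent to [v] would be joined to [v] by a chord of
the path, hence close a cycle. *)
Lemma spine_nbr p a u v w b z :
  tree e -> sorted e p -> uniq p -> dominating e [set x in p] ->
  p = a ++ u :: v :: w :: b -> e v z -> [|| z == u, z == w | leaf e z].
Proof.
move=> T so un dom Ep vz; have [[sym irr] _ ac] := T.
case: (boolP (z \in p)) => zp; last first.
  rewrite (off_path_leaf T so un dom _ zp vz) ?orbT //.
  by rewrite Ep mem_cat !inE eqxx !orbT.
move: zp; rewrite Ep mem_cat !inE => /or4P[za|->//|/eqP E|]; last first.
- case/orP=> [->|zb]; first by rewrite orbT.
  case/path.splitP: zb Ep => b1 b2 Ep.
  have Ep' : p = (a ++ [:: u]) ++ (v :: w :: rcons b1 z) ++ b2.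
    by rewrite Ep -catA /=.
  move: so un; rewrite Ep' => /cat_sorted2[_ /cat_sorted2[so _]].
  rewrite cat_uniq => /and3P[_ _]; rewrite cat_uniq => /and3P[un _ _].
  have := acyclic_path ac so un; rewrite [last _ _]/= last_rcons sym vz.
  by rewrite /= size_rcons => /(_ isT).
- by rewrite E irr in vz.
case/splitPr: za Ep => a1 a2 Ep.
have Ep' : p = a1 ++ (z :: rcons (rcons a2 u) v) ++ (w :: b).
  by rewrite Ep -catA /= !cat_rcons.
move: so un; rewrite Ep' => /cat_sorted2[_ /cat_sorted2[so _]].
rewrite cat_uniq => /and3P[_ _]; rewrite cat_uniq => /and3P[un _ _].
have := acyclic_path ac so un; rewrite [last _ _]/= last_rcons vz.
by rewrite /= !size_rcons => /(_ isT).
Qed.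

(** * The greedy selection infects the tree *)

(** The neighbours of [v] outside [S] are among [u] and [w], and by convexity at
most one neighbour of [v] is in [S].  So degree 4 or more is impossible, degree 3 forces
both [u] and [w] out of [S], and degree 2 at least one of them. *)
Lemma spine_deficit p a u v w b S :
  tree e -> sorted e p -> uniq p -> dominating e [set x in p] ->
  p = a ++ u :: v :: w :: b ->
  P3_convex e S -> leaves e \subset S -> v \notin S ->
  degree e v <= 1 + (u \notin S) + (w \notin S).
Proof.
move=> T so un dom Ep /forallP/(_ v)/implyP cS lS vS.
rewrite /degree -(cardsID S) -addnA leq_add //.
  apply: leq_trans (cS vS); apply: subset_leq_card; apply/subsetP => z.
  by rewrite !inE andbC.
have le1 x : #|[set y | (y == x) && (x \notin S)]| <= (x \notin S).
  case: (x \notin S); last by rewrite eq_card0 // => y; rewrite !inE andbF.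
  rewrite -[leqRHS]/1 -(cards1 x) subset_leq_card //.
  by apply/subsetP => y; rewrite !inE andbT.
apply: leq_trans (leq_add (le1 u) (le1 w)); apply: leq_trans (leq_card_setU _ _).
apply: subset_leq_card; apply/subsetP => z; rewrite !inE => /andP[zS vz].
have := spine_nbr T so un dom Ep vz; case/or3P => [/eqP E|/eqP E|lz].
- by rewrite -E eqxx zS.
- by rewrite -E eqxx zS orbT.
by case/negP: zS; apply: (subsetP lS); rewrite inE.
Qed.

Lemma reduced_degree_eq k v :
  k < 4 -> (reduced_degree e v == k) = (degree e v == k).
Proof. rewrite /reduced_degree; lia. Qed.

(** While a vertex is pending, the infection comes from the right: beyond the
next vertices of degree 3, the first other vertex is a leaf, has degree at least
4, or has degree 2 and is then selected, and from there the infection runs back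
through the vertices of degree 3 down to the successor of [u]. *)
Lemma pending_reaches p a u q S :
  tree e -> sorted e p -> uniq p -> dominating e [set x in p] ->
  leaf e (last u q) -> P3_convex e S -> leaves e \subset S ->
  p = a ++ u :: q -> {subset greedy (reduced_degree e) true q <= S} ->
  q != [::] -> head u q \in S.
Proof.
move=> T so un dom + cS lS; elim: q a u => //= v q IH a u lq Ep gS _.
case: q => [|w q] in IH lq Ep gS *; first by apply: (subsetP lS); rewrite inE.
apply: contraT => vS.
have dv := spine_deficit T so un dom Ep cS lS vS.
have Ep' : p = (a ++ [:: u]) ++ v :: w :: q by rewrite -catA.
have [[sym _] _ _] := T.
have nu : u != w.
  move: un; rewrite Ep cat_uniq /= !inE !negb_or.
  by case/and3P=> _ _ /andP[/and3P[]].
move: so; rewrite Ep => /cat_sorted2[_ /= /and3P[uv vw _]].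
have dv2 : 2 <= degree e v.
  have <- : #|[set u; w]| = 2 by rewrite cards2 nu.
  rewrite /degree; apply: subset_leq_card; apply/subsetP => y.
  by rewrite !inE => /orP[]/eqP-> //; rewrite sym.
move: gS; rewrite !reduced_degree_eq //.
case: eqP => [d3|d3].
  move=> /(IH _ _ lq Ep' ) /= /(_ isT) wS; move: dv; rewrite d3 wS /=; lia.
case: eqP => [d2 gS|d2 _]; last by move: dv; lia.
by case/negP: vS; apply: gS; rewrite inE eqxx.
Qed.

(** Induction along the path with the invariant that the last vertex passed,
[u], is infected. *)
Lemma greedy_spreads p a u q pending S :
  tree e -> sorted e p -> uniq p -> dominating e [set x in p] ->
  leaf e (last u q) -> P3_convex e S -> leaves e \subset S ->
  p = a ++ u :: q -> {subset greedy (reduced_degree e) pending q <= S} ->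
  u \in S -> {subset q <= S}.
Proof.
move=> T so un dom + cS lS; elim: q a u pending => //=.
move=> v q IH a u pending lq Ep gS uS.
have Ep' : p = (a ++ [:: u]) ++ v :: q by rewrite -catA.
suff vS : v \in S.
  have [pending' gS'] :
      exists b, {subset greedy (reduced_degree e) b q <= S}.
    move: gS; case: ifP => [_ gS|_]; first by exists pending.
    case: ifP => [_|_ gS]; last by exists false.
    case: pending => gS; last by exists true.
    by exists false => y yq; apply: gS; rewrite inE yq orbT.
  move=> y; rewrite inE => /orP[/eqP->//|]; exact: IH Ep' gS' vS y.
case: q => [|w q] in IH lq Ep Ep' gS *; first by apply: (subsetP lS); rewrite inE.
apply: contraT => vS.
have := spine_deficit T so un dom Ep cS lS vS; rewrite uS addn0.
have : degree e v != 0.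
  rewrite -lt0n; apply/card_gt0P; exists w.
  by move: so; rewrite Ep inE => /cat_sorted2[_ /= /and3P[]].
have : degree e v != 1 by apply: contra vS => lv; apply: (subsetP lS); rewrite inE.
case: (boolP (degree e v == 2)) => [d2 _ _|]; last lia.
move: gS; rewrite !(@reduced_degree_eq _ v) // d2 (eqP d2) [2 == 3]/=.
case: pending => gS; first by case/negP: vS; apply: gS; rewrite inE eqxx.
by have /= -> := pending_reaches T so un dom lq cS lS Ep' gS isT.
Qed.

Lemma greedy_hull_set x q :
  tree e -> dominating_leaf_path e (x :: q) ->
  P3_hull_set e
    (leaves e :|: [set v in greedy (reduced_degree e) false (x :: q)]).
Proof.
move=> T [/andP[so un] dom _ lx ly]; rewrite /P3_hull_set -subTset.
set R := _ :|: _; set S := P3_hull e R.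
have cS : P3_convex e S := P3_hull_convex e R.
have [lS gS] : leaves e \subset S /\
    [set v in greedy (reduced_degree e) false (x :: q)] \subset S.
  by apply/andP; rewrite -subUset sub_P3_hull.
have xS : x \in S by apply: (subsetP lS); rewrite inE.
have qS : {subset q <= S}.
  apply: (@greedy_spreads (x :: q) [::] x q false S T so un dom ly cS lS erefl
    _ xS) => v vq.
  apply: (subsetP gS); rewrite inE /= !reduced_degree_eq //.
  by rewrite (eqP lx).
have pS v : v \in x :: q -> v \in S by rewrite inE => /orP[/eqP->|/qS].
apply/subsetP => v _; case: (boolP (v \in x :: q)) => [/pS//|vp].
have [|[u up uv]] := dom v; first by rewrite inE (negPf vp).
apply: (subsetP lS); move: up; rewrite !inE => up.
by apply: (off_path_leaf (p := x :: q)) uv.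
Qed.

(** * Every hull set is at least as large *)

(** The complement of [C] is convex, so a hull set avoiding [C] would generate
nothing beyond that complement. *)
Lemma sealed_meets_hull_set C R :
  C != set0 -> {in C, forall x, degree e x <= #|[set y in C | e x y]|.+1} ->
  P3_hull_set e R -> ~~ [disjoint C & R].
Proof.
case/set0Pn => x xC sealed /eqP hR; apply/negP => dCR.
have cC : P3_convex e (~: C).
  apply/forallP => y; apply/implyP; rewrite inE negbK => yC.
  have := sealed y yC; rewrite /degree -(cardsID C) addnC -add1n.
  have -> : [set u | e y u] :&: C = [set u in C | e y u].
    by apply/setP => u; rewrite !inE andbC.
  rewrite leq_add2r; apply: leq_trans; apply: subset_leq_card.
  by apply/subsetP => u; rewrite !inE.
have RC : R \subset ~: C by rewrite -disjoints_subset disjoint_sym.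
by have := subsetP (P3_hull_min cC RC) x; rewrite hR !inE xC => /(_ isT).
Qed.

(** A leaf alone is sealed. *)
Lemma leaves_sub_hull_set R :
  P3_hull_set e R -> leaves e \subset R.
Proof.
move=> hR; apply/subsetP => x; rewrite inE => /eqP dx.
have : ~~ [disjoint [set x] & R].
  apply: sealed_meets_hull_set => // [|y]; last by rewrite inE => /eqP ->; rewrite dx.
  by apply/set0Pn; exists x; rewrite inE.
by rewrite disjoints1 negbK.
Qed.

(** Each vertex of the segment has a path neighbour in the segment if it is an
end, and two if it is interior; its degree exceeds this number by one. *)
Lemma sealed_segment p a t m v b R :
  simple_graph e -> sorted e p -> uniq p -> p = a ++ (t :: rcons m v) ++ b ->
  degree e t = 2 -> degree e v = 2 -> {in m, forall x, degree e x = 3} ->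
  P3_hull_set e R -> has (mem R) (t :: rcons m v).
Proof.
move=> [sym irr] so un Ep dt dv dm hR; set c := t :: rcons m v in Ep *.
have soc : sorted e c by move: so; rewrite Ep => /cat_sorted2[_ /cat_sorted2[]].
have unc : uniq c by move: un; rewrite Ep !cat_uniq => /and3P[_ _ /and3P[]].
suff : ~~ [disjoint [set x in c] & R].
  case/pred0Pn => x /andP[]; rewrite /= inE => xc xR.
  by apply/(hasP (s := c)); exists x.
apply: sealed_meets_hull_set hR.
  by apply/set0Pn; exists t; rewrite inE mem_head.
move=> x; rewrite inE => xc.
have enough_nbrs (A : {set V}) : {subset A <= [set y in [set x in c] | e x y]} ->
    degree e x <= #|A|.+1 -> degree e x <= #|[set y in [set x in c] | e x y]|.+1.
  by move=> Asub /leq_trans; apply; rewrite ltnS; apply/subset_leq_card/subsetP.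
move: xc enough_nbrs; rewrite {1}/c inE mem_rcons inE => /or3P[/eqP->|/eqP->|xm] enough_nbrs.
- apply: (enough_nbrs [set head v m]); last by rewrite cards1 dt.
  move=> y; rewrite !inE => /eqP->.
  by move: soc; rewrite /c; case: (m) => [|z m'] /= /andP[->]; rewrite !inE eqxx ?orbT.
- apply: (enough_nbrs [set last t m]); last by rewrite cards1 dv.
  move=> y; rewrite !inE => /eqP->.
  move: soc; rewrite /c /= rcons_path sym => /andP[_ ->]; rewrite andbT.
  by rewrite -in_cons -rcons_cons mem_rcons inE mem_last orbT.
have dx := dm _ xm; have [m1 [m2 Em]] : exists m1 m2, m = m1 ++ x :: m2.
  by case/splitPr: xm => m1 m2; exists m1, m2.
have Ec : c = (t :: m1) ++ x :: rcons m2 v by rewrite /c Em rcons_cat.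
have uNw : last t m1 != head v m2.
  move: unc; rewrite Ec cat_uniq => /and3P[_ /hasPn nh _].
  apply: contraTneq (mem_last t m1) => ->; apply: nh.
  by rewrite inE; case: (m2) => [|z m'] /=; rewrite !inE eqxx ?orbT.
apply: (enough_nbrs [set last t m1; head v m2]); last by rewrite cards2 uNw dx.
have [pu pw] : e (last t m1) x /\ e x (head v m2).
  move: soc; rewrite Ec /= cat_path => /and3P[_ -> /= ].
  by case: (m2) => [|z m'] /= /andP[].
move=> y; rewrite !inE -in_cons -/c => /orP[]/eqP->.
  by rewrite sym pu andbT Ec mem_cat mem_last.
rewrite pw andbT Ec mem_cat.
by case: (m2) => [|z m'] /=; rewrite !inE eqxx ?orbT.
Qed.

(** The two claims are the greedy states: without a pending vertex, the rest [q]
pays for its own selected vertices; with the pending vertex [t] followed by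
relays [m], the vertices of [t :: m] may contribute too, because the next
selected vertex is charged to the sealed segment that starts at [t].  Only
vertices other than leaves are counted, so that the bound adds to the number of
leaves. *)
Lemma greedy_le_count p a t m q R :
  simple_graph e -> sorted e p -> uniq p -> P3_hull_set e R ->
  let cnt := count [predD mem R & leaf e] in
  let g := greedy (reduced_degree e) in
  (p = a ++ q -> size (g false q) <= cnt q) /\
  (degree e t = 2 -> {in m, forall x, degree e x = 3} ->
   p = a ++ t :: m ++ q -> size (g true q) <= cnt (t :: m ++ q)).
Proof.
move=> sg so un hR cnt g; elim: q a t m => [|v q IH] a t m //.
have IHf : p = a ++ v :: q -> size (g false q) <= cnt q.
  by move=> Ep; apply: (IH (rcons a v) t m).1; rewrite cat_rcons.
split.
  move=> Ep; rewrite /g /= !reduced_degree_eq // -!/(g _ _); case: eqP => [_|_].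
    exact: leq_trans (IHf Ep) (leq_addl _ _).
  case: eqP => [d2|_]; first exact: (IH a v [::]).2.
  exact: leq_trans (IHf Ep) (leq_addl _ _).
move=> dt dm Ep; have gE : g true (v :: q) =
    if degree e v == 3 then g true q
    else if degree e v == 2 then v :: g false q else g false q.
  by rewrite /g /= !reduced_degree_eq.
rewrite {}gE.
have Ep' : p = (a ++ t :: rcons m v) ++ q by rewrite Ep -catA /= cat_rcons.
have IHq : size (g false q) <= cnt q by apply: (IH _ t m).1 Ep'.
have Ecnt : cnt (t :: m ++ v :: q) = cnt (t :: rcons m v) + cnt q.
  by rewrite -cat_rcons -cat_cons /cnt count_cat.
case: eqP => [d3|_].
  rewrite -cat_rcons; apply: (IH a t (rcons m v)).2 => //.
    by move=> x; rewrite mem_rcons inE => /orP[/eqP->|/dm].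
  by rewrite Ep cat_rcons.
rewrite Ecnt; case: eqP => [d2|_]; last exact: leq_trans IHq (leq_addl _ _).
rewrite [size _]/= -add1n leq_add // -has_count.
have Ep2 : p = a ++ (t :: rcons m v) ++ q by rewrite Ep' -catA.
have /hasP[x xc xR] := sealed_segment sg so un Ep2 dt d2 dm hR.
apply/hasP; exists x => //; apply/andP; split=> //.
rewrite -topredE /= /leaf.
move: xc; rewrite inE mem_rcons inE => /or3P[/eqP->|/eqP->|/dm->] //.
  by rewrite dt.
by rewrite d2.
Qed.

Lemma leaves_greedy_le_hull_set p R :
  simple_graph e -> sorted e p -> uniq p -> P3_hull_set e R ->
  #|leaves e| + size (greedy (reduced_degree e) false p) <= #|R|.
Proof.
move=> sg so un hR; have lR := leaves_sub_hull_set hR.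
rewrite -(cardsID (leaves e) R) leq_add //.
  by apply: subset_leq_card; rewrite subsetI lR subxx.
case: p => [|x p] in so un *; first by [].
apply: leq_trans ((@greedy_le_count _ [::] x [::] _ _ sg so un hR).1 erefl) _.
rewrite -size_filter -(card_uniqP (filter_uniq _ un)); apply: subset_leq_card.
by apply/subsetP => y; rewrite mem_filter !inE => /andP[].
Qed.

End Graph.

Theorem theorem2 (V : finType) (e : rel V) (s : seq nat) :
  caterpillar e -> 1 < #|V| -> reduced_degree_sequence e s ->
  P3_hull_number e = #|leaves e| + Z [seq d <- s | d != 3].
Proof.
move=> [T _] _ [p dp ->]; rewrite -size_greedy_Z; apply/eqP; rewrite eqn_leq.
case: p dp => // x q dp; apply/andP; split.
  apply: leq_trans (P3_hull_number_min (greedy_hull_set T dp)) _.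
  by rewrite (leq_trans (leq_card_setU _ _)) // leq_add2l cardsE card_size.
have [R hR <-] := P3_hull_number_attained e.
by case: dp T => /andP[so un] _ _ _ _ [sg _ _]; apply: leaves_greedy_le_hull_set.
Qed.
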